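(* Any interpolating EL-labeling $\lambda$ of a finite, bounded poset (in the sense of McNamara and Thomas) is polygon strong. Thus, $\lambda$ is polygon complete.
   Context: For a finite bounded poset $P$ (with least element $\hat 0$ and greatest element $\hat 1$), $\mathcal M(P)$ is the set of maximal chains, not necessarily all of the same length. For a chain $c$ and $x\in c$ write $c^x=\{w\in c: w\le x\}$, $c_x=\{w\in c: w\ge x\}$. An edge labeling $\lambda$ assigns to each cover relation a label in a poset $\Lambda$; a saturated chain gets the sequence of labels of its edges from bottom to top. A sequence is ascending if weakly increasing. $\lambda$ is an EL-labeling if for every $x<y$ the interval $[x,y]$ has a unique ascending maximal chain and it lexicographically precedes all other maximal chains of $[x,y]$. A saturated chain $u\lessdot v\lessdot w$ is a descent if $\lambda(u,v)\not\le\lambda(v,w)$. An EL-labeling $\lambda$ with integer labels is interpolating if for every $y\lessdot u\lessdot z$ in $P$ either (i) $\lambda(y,u)<\lambda(u,z)$, or (ii) the ascending maximal chain $y=w_0\lessdot w_1\lessdot\dots\lessdot w_r=z$ of $[y,z]$ has strictly increasing labels, $\lambda(w_0,w_1)=\lambda(u,z)$ and $\lambda(w_{r-1},w_r)=\lambda(y,u)$. An EL-labeling is polygon strong if for each descent $x\lessdot y\lessdot z$ one has $\lambda(y,z)<\lambda(y',z)$, where $y'$ is the coatom of $[x,z]$ contained in the unique ascending maximal chain of $[x,z]$. Polygon move: $m\to m'$ if there are $x<z$ in $m\cap m'$ with $m^x=m'^x$, $m_z=m'_z$, such that $m'\cap[x,z]$ is a descent $x\lessdot y\lessdot z$ with $y\notin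 m$, while $m\cap[x,z]$ is the unique ascending maximal chain of $[x,z]$. The maximal chain descent order $P_\lambda(2)$ is $\mathcal M(P)$ partially ordered by the reflexive and transitive closure of $\to$. $\lambda$ is polygon complete if $m\to m'$ always implies that $m'$ covers $m$ in $P_\lambda(2)$. *)

(* Defs.v *)
From mathcomp Require Import all_boot all_order all_algebra.

Set Implicit Arguments.
Unset Strict Implicit.
Unset Printing Implicit Defensive.

Import Order.TTheory.
Local Open Scope order_scope.

Section Chains.
Context {d : Order.disp_t} {P : finTBPOrderType d}.
Implicit Types (x y : P) (c A : {set P}).

Definition covers x y : bool := (x < y) && [forall w, ~~ (x < w < y)].

Definition poset_interval x y : {set P} := [set w | x <= w <= y].

Definition is_chain c : bool := [forall x in c, forall y in c, x >=< y].

Definition maximal_chain_of A c : bool :=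
  maxset (fun c' => is_chain c' && (c' \subset A)) c.

(* The two halves c^x and c_x of a chain cut at x. *)
Definition chain_below c x : {set P} := [set w in c | w <= x].
Definition chain_above c x : {set P} := [set w in c | x <= w].

End Chains.

(* The set M(P) of maximal chains of P, as a finite type. *)
Notation max_chain P := {c : {set P} | maximal_chain_of [set: P] c}.

Section EdgeLabelings.
Context {d d' : Order.disp_t} {P : finTBPOrderType d} {L : porderType d'}.

(* An edge labeling is a total function of two arguments, of which only the
   values lam x y with [covers x y] are ever used. *)
Variable lam : P -> P -> L.

(* On a chain, sort lists the elements from bottom to top. *)
Definition labels (c : {set P}) : seq L :=
  if sort <=%O (enum c) is x :: s then pairmap lam x s else [::].

Definition ascending (c : {set P}) : bool := sorted <=%O (labels c).

Definition asc_max_chain (x z : P) (c : {set P}) : bool :=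
  maximal_chain_of (poset_interval x z) c && ascending c.

(* seqlexi is the lexicographic order in which a proper prefix comes first. *)
Definition EL_labeling : Prop :=
  forall x y : P, x < y ->
    exists c : {set P},
      unique (asc_max_chain x y) c /\
      forall c' : {set P},
        maximal_chain_of (poset_interval x y) c' -> c' != c ->
        (labels c : seqlexi L) < labels c'.

Definition descent (x y z : P) : bool :=
  [&& covers x y, covers y z & ~~ (lam x y <= lam y z)].

Definition polygon_strong : Prop :=
  EL_labeling /\
  forall x y z : P, descent x y z ->
    forall (c : {set P}) (y' : P),
      asc_max_chain x z c -> y' \in c -> covers y' z ->
      lam y z < lam y' z.

Definition polygon_move : rel (max_chain P) := fun m m' =>
  [exists x, exists y, exists z,
    [&& x < z, x \in val m :&: val m', z \in val m :&: val m',
        chain_below (val m) x == chain_below (val m') x,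
        chain_above (val m) z == chain_above (val m') z,
        descent x y z,
        val m' :&: poset_interval x z == [set x; y; z],
        y \notin val m &
        asc_max_chain x z (val m :&: poset_interval x z)]].

(* The order relation of the maximal chain descent order P_lambda(2);
   connect is the reflexive and transitive closure. *)
Definition mcd_le : rel (max_chain P) := connect polygon_move.

Definition mcd_lt : rel (max_chain P) :=
  fun m m' => mcd_le m m' && (m != m').

Definition mcd_covers : rel (max_chain P) :=
  fun m m' => mcd_lt m m' && [forall m'', ~~ (mcd_lt m m'' && mcd_lt m'' m')].

Definition polygon_complete : Prop :=
  EL_labeling /\
  forall m m' : max_chain P, polygon_move m m' -> mcd_covers m m'.

End EdgeLabelings.

(* In the second case c is w_0 < ... < w_r, v is w_1 and v' is w_(r-1). *)
Definition interpolating {d : Order.disp_t} {P : finTBPOrderType d}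
    (lam : P -> P -> int) : Prop :=
  EL_labeling lam /\
  forall y u z : P, covers y u -> covers u z ->
    lam y u < lam u z \/
    exists (c : {set P}) (v v' : P),
      [/\ asc_max_chain lam y z c /\ sorted <%O (labels lam c),
          [/\ v \in c, covers y v & lam y v = lam u z] &
          [/\ v' \in c, covers v' z & lam v' z = lam y u]].

(* Main.v *)
Require Import Defs.
From mathcomp Require Import all_boot all_order all_algebra.

(** For a descent [x, y, z], clause (i) of the interpolation condition is
    excluded, so clause (ii) says that the ascending chain of [[x, z]] starts
    with the label [lam y z] and ends with the label [lam x y], the two labels
    of the descent in exchanged positions.  Since [lam y z < lam x y], the last
    label of the ascending chain exceeds that of the descent: this is polygon
    strength.

    For completeness, the exchange of labels is used at both ends.  A polygon
    move [m -> m'] over [[x, z]] leaves the chain unchanged up to [x] and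
    strictly increases the label of the edge going up from [x]; it also leaves
    the chain unchanged from [z] on and strictly decreases the label of the
    edge going down from [z].  Hence every move is an increase for the order
    that compares two chains at the element where they branch when read from
    the bottom, and, dually, a decrease when they are read from the top
    ([move_branches], [move_branches_dual]).  Both comparisons are transitive
    ([branch_trans]), irreflexive, and convex: a chain between two chains that
    agree up to [x] agrees with them up to [x] ([branch_sandwich]).

    Now let [m -> m'] be a move over [[x, z]] through [y], let
    [m <= m'' < m'], and let [m3 -> m'] be the last move on a way from [m''] to
    [m'].  By convexity [m3] agrees with [m] below [x] and above [z], so the
    element that the last move inserts lies strictly between [x] and [z] in
    [m'], hence is [y], and the last move is also over [[x, z]].  Therefore
    [m3] has the ascending chain in [[x, z]], that is, [m3 = m]; by
    antisymmetry [m'' = m], so nothing lies strictly between [m] and [m']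
    ([move_source_unique], [move_covers]). *)

Set Implicit Arguments.
Unset Strict Implicit.
Unset Printing Implicit Defensive.

Import Order.TTheory.
Local Open Scope order_scope.

(** * Comparing chains at their branching point *)

Section Branching.
Context {d d' : Order.disp_t} {P : finTBPOrderType d} {L : porderType d'}.
Implicit Types (a b x y z w : P) (m : {set P}).

Lemma chain_comparable m x y : is_chain m -> x \in m -> y \in m -> x >=< y.
Proof. by move=> /forall_inP mP xm ym; have /forall_inP/(_ y ym) := mP x xm. Qed.

Lemma covers_chain_le m a b w :
  is_chain m -> b \in m -> w \in m -> covers a b -> a < w -> b <= w.
Proof.
move=> mC bm wm /andP[_ /forallP/(_ w)] + aw; rewrite aw /=.
by case: (comparable_ltgtP (chain_comparable mC bm wm)).
Qed.

Lemma covers_chain_inj m a b b' :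
  is_chain m -> b \in m -> b' \in m -> covers a b -> covers a b' -> b = b'.
Proof.
move=> mC bm b'm ab ab'; apply/le_anti.
rewrite (covers_chain_le mC bm b'm ab (proj1 (andP ab'))).
by rewrite (covers_chain_le mC b'm bm ab' (proj1 (andP ab))).
Qed.

Definition agree_below m m' a := forall w, w <= a -> (w \in m) = (w \in m').

Lemma agree_below_trans m1 m2 m3 a a1 a2 : a <= a1 -> a <= a2 ->
  agree_below m1 m2 a1 -> agree_below m2 m3 a2 -> agree_below m1 m3 a.
Proof.
by move=> aa1 aa2 e1 e2 w wa; rewrite e1 ?e2 // (le_trans wa).
Qed.

Variable lab : P -> P -> L.

(** The strict comparison read from the bottom.  The branching point [a] is
    explicit because convexity depends on where chains branch.  The
    chains themselves, rather than their label words, are required to agree up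
    to [a], since distinct chains may carry the same labels. *)
Definition branch_at a m m' : Prop :=
  agree_below m m' a /\ exists b b',
    [/\ a \in m, b \in m, b' \in m' &
     [/\ covers a b, covers a b' & lab a b < lab a b']].

Definition branch_lt m m' : Prop := exists a, branch_at a m m'.

(** Two successive comparisons compose at the lower of the two branching
    points, because the chain in the middle still follows the outer one past
    that point. *)
Lemma branch_at_trans m1 m2 m3 a a' : is_chain m2 ->
  branch_at a m1 m2 -> branch_at a' m2 m3 ->
  a \in m2 /\ a' \in m2 /\
  (a <= a' -> branch_at a m1 m3) /\ (a' < a -> branch_at a' m1 m3).
Proof.
move=> m2C [e12 [b [b2 [am1 bm1 b2m2 [ab ab2 lt12]]]]].
move=> [e23 [c2 [c [a'm2 c2m2 cm3 [a'c2 a'c lt23]]]]].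
have am2 : a \in m2 by rewrite -e12.
split=> //; split=> //; split.
- rewrite le_eqVlt => /orP[/eqP aa'|aa'].
    rewrite -aa' in a'c2 a'c lt23 e23.
    split; first exact: agree_below_trans e12 e23.
    exists b, c; split=> //; split=> //; apply: lt_trans lt12 _.
    by rewrite (covers_chain_inj m2C b2m2 c2m2 ab2 a'c2).
  split; first exact: agree_below_trans (ltW aa') e12 e23.
  exists b, b2; split=> //; rewrite -e23 //.
  exact: covers_chain_le m2C b2m2 a'm2 ab2 aa'.
- move=> a'a; split; first exact: agree_below_trans (ltW a'a) _ e12 e23.
  exists c2, c; split=> //; rewrite e12 ?(ltW a'a) //.
  exact: covers_chain_le m2C c2m2 am2 a'c2 a'a.
Qed.

Lemma branch_trans m1 m2 m3 : is_chain m2 ->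
  branch_lt m1 m2 -> branch_lt m2 m3 -> branch_lt m1 m3.
Proof.
move=> m2C [a Da] [a' Da'].
have [am2 [a'm2 [le_aa' lt_a'a]]] := branch_at_trans m2C Da Da'.
case: (comparable_leP (chain_comparable m2C am2 a'm2)) => [/le_aa'|/lt_a'a] ?.
  by exists a.
by exists a'.
Qed.

Lemma branch_irr m : is_chain m -> ~ branch_lt m m.
Proof.
move=> mC [a [_ [b [b' [_ bm b'm [ab ab']]]]]].
by rewrite (covers_chain_inj mC bm b'm ab ab') ltxx.
Qed.

(** If the chains branched at some [a < x], then the edge of [m] going up from
    [a] would end at or below [x], hence belong to [m'] too, while the two
    edges going up from [a] carry distinct labels. *)
Lemma branch_at_agree m m' a x : is_chain m -> is_chain m' -> x \in m ->
  agree_below m m' x -> branch_at a m m' -> ~~ (a < x).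
Proof.
move=> mC m'C xm e [_ [b [b' [am bm b'm' [ab ab' lt]]]]]; apply/negP => ax.
have bm' : b \in m' by rewrite -e // (covers_chain_le mC bm xm ab ax).
by rewrite (covers_chain_inj m'C bm' b'm' ab ab') ltxx in lt.
Qed.

(** Convexity.  If the middle chain left the common part below [x], then the
    lower of the two branching points, at which the outer chains branch by
    [branch_at_trans], would lie below [x], against [branch_at_agree]. *)
Lemma branch_sandwich m1 m2 m3 x :
    is_chain m1 -> is_chain m2 -> is_chain m3 -> x \in m1 ->
    m1 = m2 \/ branch_lt m1 m2 -> m2 = m3 \/ branch_lt m2 m3 ->
  agree_below m1 m3 x -> agree_below m1 m2 x.
Proof.
move=> C1 C2 C3 xm1 [->|[a D12]] // [->|[a' D23]] // e13.
have [am2 [a'm2 [le_aa' lt_a'a]]] := branch_at_trans C2 D12 D23.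
have e12 := proj1 D12; have am1 : a \in m1 by rewrite e12.
case: (comparable_leP (chain_comparable C1 xm1 am1)) => [xa|ax].
  by move=> w wx; rewrite e12 // (le_trans wx).
case: (comparable_leP (chain_comparable C2 am2 a'm2)) => [/le_aa'|a'a].
  by move/(branch_at_agree C1 C3 xm1 e13)/negP.
have /(branch_at_agree C1 C3 xm1 e13)/negP[] := lt_a'a a'a.
exact: lt_trans a'a ax.
Qed.

End Branching.

(** * Duality *)

Section Duality.
Context {d : Order.disp_t} {P : finTBPOrderType d}.
Implicit Types (a b x : P) (m : {set P}).

Lemma covers_dual a b : covers a b -> @covers _ P^d b a.
Proof.
by move=> /andP[ab /forallP n]; apply/andP; split=> //; apply/forallP => w;
   rewrite andbC; apply: n.
Qed.

Lemma is_chain_dual m : is_chain m -> @is_chain _ P^d m.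
Proof.
move=> /forall_inP mP; apply/forall_inP => x xm; apply/forall_inP => y ym.
by have /forall_inP/(_ y ym) := mP x xm; rewrite /Order.comparable orbC.
Qed.

Lemma cocovers_chain_inj m a a' b : is_chain m -> a \in m -> a' \in m ->
  covers a b -> covers a' b -> a = a'.
Proof.
move=> /is_chain_dual mC am a'm /covers_dual ab /covers_dual a'b.
exact: (@covers_chain_inj _ P^d m b).
Qed.

Lemma maximal_is_chain A m : maximal_chain_of A m -> is_chain m.
Proof. by move=> /maxsetp/andP[]. Qed.

Lemma chain_below_agree m m' x :
  chain_below m x = chain_below m' x -> agree_below m m' x.
Proof. by move=> /setP e w wx; have := e w; rewrite !inE wx !andbT. Qed.

Lemma chain_above_agree m m' x :
  chain_above m x = chain_above m' x -> @agree_below _ P^d m m' x.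
Proof.
by move=> /setP e w wx; have := e w; rewrite !inE (wx : x <= w) !andbT.
Qed.

End Duality.

(** * Reflexive-transitive closures *)

Section Connect.
Variables (T : finType) (e : rel T).

Lemma connect_sub_trans (R : T -> T -> Prop) :
    (forall x y z, R x y -> R y z -> R x z) -> (forall x y, e x y -> R x y) ->
  forall x y, connect e x y -> x = y \/ R x y.
Proof.
move=> Rtr eR x y /connectP[p]; elim: p x => [|z p IH] x /=; first by left.
move=> /andP[/eR xz /IH{}IH] /IH[<-|zy]; right=> //; exact: Rtr zy.
Qed.

Lemma connect_last_step x y :
  connect e x y -> x != y -> exists2 z, connect e x z & e z y.
Proof.
case/connectP => p; case/lastP: p => [_ -> /eqP//|p z].
rewrite rcons_path last_rcons => /andP[xp ez] -> _.
by exists (last x p) => //; apply/connectP; exists p.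
Qed.

End Connect.

(** * Interpolating labelings *)

Section Interpolating.
Context {d : Order.disp_t} {P : finTBPOrderType d}.
Variable lam : P -> P -> int.
Hypothesis lam_int : interpolating lam.
Implicit Types (x y z : P) (c : {set P}) (m : max_chain P).

Lemma asc_max_chain_inj x z c c' : x < z ->
  asc_max_chain lam x z c -> asc_max_chain lam x z c' -> c = c'.
Proof.
by case: lam_int => EL _ /EL[c0 [[_ u] _]] /u <- /u <-.
Qed.

Lemma descent_lt x y z : descent lam x y z -> x < z.
Proof. by case/and3P => /andP[xy _] /andP[yz _] _; apply: lt_trans yz. Qed.

(** A descent excludes clause (i) of the interpolation condition; the chain
    provided by clause (ii) is identified with the given one by the uniqueness
    in the definition of EL-labelings. *)
Lemma descent_exchange x y z c :
    descent lam x y z -> asc_max_chain lam x z c ->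
  lam y z < lam x y /\ exists v v',
    [/\ v \in c, covers x v & lam x v = lam y z] /\
    [/\ v' \in c, covers v' z & lam v' z = lam x y].
Proof.
move=> D cA; have xz := descent_lt D; case/and3P: D => xy yz.
rewrite -ltNge => lt; split=> //.
case: lam_int => _ /(_ x y z xy yz) [|[c0 [v [v' [[c0A _] v1 v2]]]]].
  by rewrite ltNge (ltW lt).
by exists v, v'; rewrite (asc_max_chain_inj xz cA c0A).
Qed.

Lemma interpolating_polygon_strong : polygon_strong lam.
Proof.
split=> [|x y z D c y' cA y'c y'z]; first exact: (proj1 lam_int).
have [lt [v [v' [_ [v'c v'z e]]]]] := descent_exchange D cA.
have cC := maximal_is_chain (proj1 (andP cA)).
by rewrite (cocovers_chain_inj cC y'c v'c y'z v'z) e.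
Qed.

(** The content of a polygon move with its witnesses named; agreement above
    [z] is agreement below [z] in the dual order. *)
Definition move_over x y z m m' : Prop :=
  [/\ [/\ x \in val m, x \in val m', z \in val m & z \in val m'],
      agree_below (val m) (val m') x, @agree_below _ P^d (val m) (val m') z,
      [/\ descent lam x y z, y \in val m' & y \notin val m] &
      val m' :&: poset_interval x z = [set x; y; z] /\
      asc_max_chain lam x z (val m :&: poset_interval x z)].

Lemma polygon_moveP m m' :
  polygon_move lam m m' -> exists x y z, move_over x y z m m'.
Proof.
case/existsP => x /existsP[y /existsP[z]] H; exists x, y, z; move: H.
case/and5P => xz /setIP[xm xm'] /setIP[zm zm'] /eqP eb /and5P[/eqP et D].
move=> /eqP I ym A; have : y \in val m' :&: poset_interval x z.
  by rewrite I !inE eqxx orbT.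
by case/setIP => ym' _; split=> //; [exact: chain_below_agree|exact: chain_above_agree].
Qed.

Lemma val_chain m : is_chain (val m).
Proof. exact: maximal_is_chain (valP m). Qed.

(** The chain [m] goes up from [x] along the ascending chain, whose first label
    [lam y z] is below the label [lam x y] of the edge by which [m'] leaves
    [x]. *)
Lemma move_branches m m' :
  polygon_move lam m m' -> branch_lt lam (val m) (val m').
Proof.
case/polygon_moveP => x [y [z [[xm _ _ _] eb _ [D ym' _] [_ A]]]].
have [lt [v [_ [[/setIP[vm _] xv e] _]]]] := descent_exchange D A.
exists x; split=> //; exists v, y; split=> //; split=> //; last by rewrite e.
by case/and3P: D.
Qed.

(** The same at the upper end; in the dual order the roles of [m] and [m'] are
    exchanged because the last label decreases. *)
Lemma move_branches_dual m m' : polygon_move lam m m' ->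
  @branch_lt _ _ P^d _ (fun b a => lam a b) (val m') (val m).
Proof.
case/polygon_moveP => x [y [z [[_ _ zm zm'] _ et [D ym' _] [_ A]]]].
have [lt [_ [v [_ [/setIP[vm _] vz e]]]]] := descent_exchange D A.
exists z; split; first by move=> w /et.
exists y, v; split=> //; split; [|exact: covers_dual|by rewrite e].
by case/and3P: D => _ yz _; apply: covers_dual.
Qed.

Lemma mcd_branches m m' : mcd_le lam m m' ->
  val m = val m' \/ branch_lt lam (val m) (val m').
Proof.
move=> le; have [] := connect_sub_trans (R := fun m m' =>
  branch_lt lam (val m) (val m')) _ move_branches le; last by right.
  by move=> m1 m2 m3; apply: branch_trans (val_chain m2).
by left; congr val.
Qed.

Lemma mcd_branches_dual m m' : mcd_le lam m m' ->
  val m' = val m \/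
  @branch_lt _ _ P^d _ (fun b a => lam a b) (val m') (val m).
Proof.
move=> le; have [] := connect_sub_trans (R := fun m m' =>
  @branch_lt _ _ P^d _ (fun b a => lam a b) (val m') (val m))
  _ move_branches_dual le; last by right.
  move=> m1 m2 m3 D12 D23.
  exact: branch_trans (is_chain_dual (val_chain m2)) D23 D12.
by left; congr val.
Qed.

(** Going up and back down would make a chain branch off itself. *)
Lemma mcd_anti m m' : mcd_le lam m m' -> mcd_le lam m' m -> m = m'.
Proof.
move=> /mcd_branches[/val_inj//|D] /mcd_branches[/val_inj//|D'].
by case: (branch_irr (val_chain m) (branch_trans (val_chain m') D D')).
Qed.

(** Only one last move can lead to [m'] from a chain above [m].  By
    convexity, read from both ends, the element that it inserts lies strictly
    between [x] and [z], and [y] is the only such element of [m']. *)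
Lemma move_source_unique m m' m3 : polygon_move lam m m' ->
  mcd_le lam m m3 -> polygon_move lam m3 m' -> m3 = m.
Proof.
move=> /polygon_moveP[x [y [z [[xm xm' zm zm'] eb et [D ym' ym] [I A]]]]] le3.
move=> mv3; have le3' : mcd_le lam m3 m' := connect1 mv3.
have [[C C'] C3] := (val_chain m, val_chain m', val_chain m3).
have eb3 : agree_below (val m) (val m3) x.
  exact: branch_sandwich C C3 C' xm (mcd_branches le3) (mcd_branches le3') eb.
have et3 : @agree_below _ P^d (val m') (val m3) z.
  apply: (branch_sandwich (is_chain_dual C') (is_chain_dual C3)
    (is_chain_dual C) zm' (mcd_branches_dual le3') (mcd_branches_dual le3)).
  by move=> w /et.
move/polygon_moveP: mv3 => [a [y2 [b [[am3 am' bm3 bm'] _ _ [D2 y2m' y2m3]]]]].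
move=> [_ A3].
(* The inserted element is not in [m3], so it avoids the parts of [m'] that
   are shared with [m3]. *)
have ny2x : ~~ (y2 <= x).
  by apply: contra y2m3 => h; rewrite -eb3 // eb.
have nzy2 : ~~ (z <= y2).
  by apply: contra y2m3 => h; rewrite -et3.
have y2y : y2 = y.
  have : y2 \in val m' :&: poset_interval x z.
    rewrite !inE y2m' /=.
    case: (comparable_ltgtP (chain_comparable C' xm' y2m')) ny2x => //= _ _.
    by case: (comparable_ltgtP (chain_comparable C' zm' y2m')) nzy2.
  rewrite I !inE => /orP[/orP[/eqP e|/eqP//]|/eqP e].
    by rewrite e lexx in ny2x.
  by rewrite e lexx in nzy2.
have xz := descent_lt D.
case/and3P: D => xy yz _; case/and3P: D2; rewrite y2y => ay yb _.
(* In the chain [m'] the neighbours of [y] are determined, so both moves are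
   over the same interval. *)
rewrite (cocovers_chain_inj C' am' xm' ay xy) in A3.
rewrite (covers_chain_inj C' bm' zm' yb yz) in A3.
have /setP E := asc_max_chain_inj xz A3 A.
have et3' w : z <= w -> (w \in val m) = (w \in val m3).
  by move=> zw; rewrite -(et3 w zw) (et w zw).
have xm3 : x \in val m3 by rewrite -eb3.
have zm3 : z \in val m3 by rewrite -et3'.
(* An element in neither chain may be incomparable to [x] or [z], so the
   three parts of the chains only exhaust the elements of their union. *)
have step w : (w \in val m3) || (w \in val m) ->
    (w \in val m3) = (w \in val m).
  move=> ww; have [wx|nwx] := boolP (w <= x); first by rewrite eb3.
  have [zw|nzw] := boolP (z <= w); first by rewrite et3'.
  have /andP[cx cz] : (x >=< w) && (z >=< w).
    by case/orP: ww => ww; rewrite !(chain_comparable _ _ ww).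
  have := E w; rewrite !inE.
  case: (comparable_ltgtP cx) nwx => //= _ _.
  by case: (comparable_ltgtP cz) nzw => //= _ _; rewrite !andbT.
apply/val_inj/setP => w.
have := step w; case: (w \in val m3) => /=; first by move=> ->.
by case: (w \in val m) => //= ->.
Qed.

Lemma move_covers m m' : polygon_move lam m m' -> mcd_covers lam m m'.
Proof.
move=> mv; apply/andP; split.
  apply/andP; split; first exact: connect1.
  have [x [y [z [_ _ _ [_ ym' ym] _]]]] := polygon_moveP mv.
  by apply: contraNneq ym => ->.
apply/forallP => m2; apply/negP => /andP[/andP[le2 ne2] /andP[le2' ne2']].
have [m3 le23 mv3] := connect_last_step le2' ne2'.
have e3 := move_source_unique mv (connect_trans le2 le23) mv3.
rewrite e3 in le23.
by move/eqP: ne2; apply; apply: mcd_anti.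
Qed.

End Interpolating.

Theorem theorem4p15 (d : Order.disp_t) (P : finTBPOrderType d)
    (lam : P -> P -> int) :
  interpolating lam -> polygon_strong lam /\ polygon_complete lam.
Proof.
move=> lam_int; split; first exact: interpolating_polygon_strong.
by split=> [|m m']; [exact: (proj1 lam_int)|exact: move_covers].
Qed.
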